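(* Let $D\ge 1$ and let $\mathcal{A}^D_{\hbar,q}(\mathcal{F})$ be a shift algebra such that $\mathcal{F}$ separates points of $\mathbb{R}^D$. Let $R\in\mathrm{Mat}_D(\mathbb{Z})$ with $\det R\ne0$ and $\delta\in\mathbb{R}^D$. Then the left $\mathcal{A}^D_{\hbar,q}(\mathcal{F})$-module $\mathcal{S}_\hbar(R,\delta)$ is simple if and only if $R\in\mathrm{GL}_D(\mathbb{Z})$.
   Context: $F(\mathbb{R}^D,\mathbb{C})$ is the $\ast$-algebra of all complex valued functions on $\mathbb{R}^D$ (involution = complex conjugation). For $\hbar>0$, $k\in\mathbb{Z}^D$ put $(S_\hbar^k f)(u)=f(u+k\hbar)$. A $\ast$-subalgebra $\mathcal{F}\subseteq F(\mathbb{R}^D,\mathbb{C})$ is $\hbar$-invariant if $S_\hbar^kf\in\mathcal{F}$ for all $f\in\mathcal{F}$, $k\in\mathbb{Z}^D$; it separates points if for any distinct $x,y\in\mathbb{R}^D$ there is $f\in\mathcal{F}$ with $f(x)\ne f(y)$. For $k,l\in\mathbb{R}^D$ let $N(k,l)=\sum_{m=2}^D\sum_{n=1}^{m-1}k_ml_n$ (and $N=0$ if $D=1$). For $q\in\mathbb{C}$, $|q|=1$, a real $\theta$ with $q=e^{i\theta}$ is fixed and $q^t=e^{i\theta t}$ for $t\in\mathbb{R}$. Shift algebra: for $\hbar>0$, $|q|=1$ and $\mathcal{F}$ an $\hbar$-invariant $\ast$-subalgebra of $F(\mathbb{R}^D,\mathbb{C})$, $\mathcal{A}^D_{\hbar,q}(\mathcal{F})$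 consists of finite formal sums $\sum_{k\in\mathbb{Z}^D}f_kU^k$, $f_k\in\mathcal{F}$, with product $(\sum_kf_kU^k)(\sum_lg_lU^l)=\sum_{k,l}q^{N(k,l)}f_k(S_\hbar^kg_l)U^{k+l}$. Modules: for $R\in\mathrm{Mat}_D(\mathbb{Z})$ with $\det R\neq0$ and $\delta\in\mathbb{R}^D$, $\mathcal{S}_\hbar(R,\delta)$ is the space of finitely supported functions $\xi:\mathbb{Z}^D\to\mathbb{C}$ with the left action $(f\xi)(k)=\sum_{n\in\mathbb{Z}^D}q^{N(R^{-1}k+\delta,n)}f_n\big((R^{-1}k+\delta)\hbar\big)\xi(k+Rn)$ for $f=\sum_nf_nU^n$. A module is simple if it is nonzero and its only submodules are $0$ and itself. *)

(* Defs.v *)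
From HB Require Import structures.
From mathcomp Require Import all_boot all_order all_algebra.
From mathcomp Require Import ring finmap complex.
From mathcomp Require Import boolp classical_sets functions cardinality fsbigop.
From mathcomp Require Import reals trigo.

Set Implicit Arguments.
Unset Strict Implicit.
Unset Printing Implicit Defensive.

Import Order.TTheory GRing.Theory Num.Theory.
Local Open Scope classical_set_scope.
Local Open Scope ring_scope.

(* Associative algebras without a unit, and left modules over them: a         *)
(* *-subalgebra of functions need not contain the constant 1.                 *)
Record nuAlgebra (C : comNzRingType) := NUAlgebra {
  nualg_sort :> lmodType C;
  nuM : nualg_sort -> nualg_sort -> nualg_sort;
  nuMA : associative nuM;
  nuMDl : left_distributive nuM +%R;
  nuMDr : right_distributive nuM +%R;
  nuMZl : forall c a b, nuM (c *: a) b = c *: nuM a b;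
  nuMZr : forall c a b, nuM a (c *: b) = c *: nuM a b
}.

Record leftModule (C : comNzRingType) (A : nuAlgebra C) := LeftModule {
  lm_sort :> lmodType C;
  lm_act : A -> lm_sort -> lm_sort;
  lm_actM : forall a b x, lm_act (nuM a b) x = lm_act a (lm_act b x);
  lm_actDl : forall a b x, lm_act (a + b) x = lm_act a x + lm_act b x;
  lm_actDr : forall a x y, lm_act a (x + y) = lm_act a x + lm_act a y;
  lm_actZl : forall c a x, lm_act (c *: a) x = c *: lm_act a x;
  lm_actZr : forall c a x, lm_act a (c *: x) = c *: lm_act a x
}.

Definition is_submodule (C : comNzRingType) (A : nuAlgebra C)
    (M : leftModule A) (V : set M) : Prop :=
  [/\ V 0,
      forall x y, V x -> V y -> V (x + y),
      forall (c : C) x, V x -> V (c *: x) &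
      forall (a : A) x, V x -> V (lm_act a x)].

Definition simple_module (C : comNzRingType) (A : nuAlgebra C)
    (M : leftModule A) : Prop :=
  (exists x : M, x <> 0) /\
  (forall V : set M, is_submodule V -> V = [set 0] \/ V = setT).

(* F(R^D, C); the regular structure [K[i]^o] makes it a K[i]-module. *)
Notation funsp K D := ('cV[K]_D -> K[i]^o).

Section Functions.
Variables (K : realType) (D : nat).
Local Notation funsp := (funsp K D).

Definition vecZ (k : 'cV[int]_D) : 'cV[K]_D := map_mx intr k.

Definition shiftS (hbar : K) (k : 'cV[int]_D) (f : funsp) : funsp :=
  fun u => f (u + hbar *: vecZ k).

Record star_subalgebra (F : set funsp) : Prop := StarSubalgebra {
  ssa0 : F (fun=> 0);
  ssaD : forall f g, F f -> F g -> F (fun u => f u + g u);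
  ssaZ : forall (c : K[i]) f, F f -> F (fun u => c * f u);
  ssaM : forall f g, F f -> F g -> F (fun u => f u * g u);
  ssa_conj : forall f, F f -> F (fun u => conjc (f u))
}.

Definition shift_invariant (hbar : K) (F : set funsp) : Prop :=
  forall f k, F f -> F (shiftS hbar k f).

Definition separates_points (F : set funsp) : Prop :=
  forall x y : 'cV[K]_D, x <> y -> exists2 f, F f & f x <> f y.

Definition NN (k l : 'cV[K]_D) : K :=
  \sum_(m < D) \sum_(n < D | (n < m)%N) k m 0 * l n 0.

End Functions.

Definition expi (K : realType) (t : K) : K[i] := (cos t +i* sin t)%C.

(* q^t for q = e^{i theta} *)
Definition qpow (K : realType) (theta t : K) : K[i] := expi (theta * t).

Section NNTheory.
Variables (K : realType) (D : nat).

Lemma NNDl (k k' l : 'cV[K]_D) : NN (k + k') l = NN k l + NN k' l.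
Proof.
rewrite /NN -big_split /=; apply: eq_bigr => m _.
by rewrite -big_split /=; apply: eq_bigr => n _; rewrite mxE mulrDl.
Qed.

Lemma NNDr (k l l' : 'cV[K]_D) : NN k (l + l') = NN k l + NN k l'.
Proof.
rewrite /NN -big_split /=; apply: eq_bigr => m _.
by rewrite -big_split /=; apply: eq_bigr => n _; rewrite mxE mulrDr.
Qed.

Lemma vecZD (k l : 'cV[int]_D) : vecZ K (k + l) = vecZ K k + vecZ K l.
Proof. exact: map_mxD. Qed.

Lemma qpowD (theta s t : K) :
  qpow theta (s + t) = qpow theta s * qpow theta t.
Proof.
rewrite /qpow /expi mulrDr cosD sinD; apply/eqP; rewrite eq_complex /=.
by rewrite addrC eqxx /= [sin _ * _ + _]addrC eqxx.
Qed.

End NNTheory.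

Section FinSupp.
Variables (I : choiceType) (V : zmodType).

Definition finsupp_fun (a : I -> V) : Prop := finite_set [set i | a i <> 0].

Lemma finsupp_fun0 : finsupp_fun (fun=> 0).
Proof. by apply: (sub_finite_set _ (finite_set0 I)) => i /=. Qed.

Lemma finsupp_funD a b :
  finsupp_fun a -> finsupp_fun b -> finsupp_fun (fun i => a i + b i).
Proof.
move=> fa fb; apply: (@sub_finite_set _ _ ([set i | a i <> 0] `|` [set i | b i <> 0])).
  move=> i /= abi; have [ai0|/eqP] := eqVneq (a i) 0; last by left.
  by right=> bi0; apply: abi; rewrite ai0 bi0 addr0.
by rewrite finite_setU.
Qed.

Lemma finsupp_seq a : finsupp_fun a ->
  exists2 s : seq I, uniq s & forall i, i \notin s -> a i = 0.
Proof.
move=> fa; exists (fset_set [set i | a i <> 0]); first exact: fset_uniq.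
move=> i; rewrite in_fset_set// notin_setE /=.
by move=> /contrapT.
Qed.

End FinSupp.

Lemma fsum_seq (I : choiceType) (V : zmodType) (s : seq I) (f : I -> V) :
  uniq s -> (forall i, i \notin s -> f i = 0) ->
  \sum_(i \in [set: I]) f i = \sum_(i <- s) f i.
Proof.
move=> us fs; rewrite (fsbigE s) //=; last by move=> i _; exact: fs.
by apply: eq_bigl => i; exact/asboolP.
Qed.

Section ShiftAlgebra.
Variables (K : realType) (D : nat) (F : set (funsp K D)) (hbar theta : K).
Hypothesis ssF : star_subalgebra F.
Hypothesis invF : shift_invariant hbar F.

Local Notation C := (K[i]).
Local Notation Z := ('cV[int]_D).
Local Notation X := ('cV[K]_D).

Local Notation coefs := (Z -> funsp K D).

Definition shift_pred (_ : star_subalgebra F) : {pred coefs} :=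
  fun a => `[< finsupp_fun a /\ forall k, F (a k) >].

Lemma shift_predP (a : coefs) :
  reflect (finsupp_fun a /\ forall k, F (a k)) (a \in shift_pred ssF).
Proof. exact: asboolP. Qed.

Fact shift_pred_submod : submod_closed (shift_pred ssF).
Proof.
split.
  by apply/shift_predP; split=> [|k]; [exact: finsupp_fun0|exact: ssa0].
move=> c a b /shift_predP[fa Fa] /shift_predP[fb Fb]; apply/shift_predP.
split=> [|k]; last exact: (ssaD ssF (ssaZ ssF c (Fa k)) (Fb k)).
apply: finsupp_funD => //; apply: sub_finite_set fa => k /=.
by apply: contra_not => ak; rewrite -[LHS]/(c *: a k) ak scaler0.
Qed.

HB.instance Definition _ :=
  GRing.isSubmodClosed.Build C coefs (shift_pred ssF) shift_pred_submod.

(* The formal sum \sum_k (a k) U^k is encoded by its coefficient function. *)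
Record shift_elt := ShiftElt { coef :> coefs; _ : coef \in shift_pred ssF }.
HB.instance Definition _ := [isSub for coef].
HB.instance Definition _ := [Choice of shift_elt by <:].
HB.instance Definition _ := [SubChoice_isSubLmodule of shift_elt by <:].

(* f U^k *)
Definition mono (k : Z) (f : funsp K D) : coefs :=
  fun l => if l == k then f else 0.

Definition shift_mul_raw (a b : coefs) : coefs :=
  \sum_(k \in [set: Z]) \sum_(l \in [set: Z])
     mono (k + l) (fun u =>
       qpow theta (NN (vecZ K k) (vecZ K l)) * (a k u * shiftS hbar k (b l) u)).


Let term (a b : coefs) (k l : Z) : funsp K D := fun u =>
  qpow theta (NN (vecZ K k) (vecZ K l)) * (a k u * shiftS hbar k (b l) u).

Lemma mono0 k : mono k 0 = 0.
Proof. by apply/funext => l; rewrite /mono; case: ifP. Qed.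

Lemma monoD k f g : mono k (f + g) = mono k f + mono k g.
Proof.
apply/funext => l; rewrite -[RHS]/(mono k f l + mono k g l) /mono.
by case: ifP => // _; rewrite addr0.
Qed.

Lemma monoZ k (c : C) f : mono k (c *: f) = c *: mono k f.
Proof.
apply/funext => l; rewrite (_ : (c *: mono k f) l = c *: mono k f l)// /mono.
by case: ifP => // _; rewrite scaler0.
Qed.

Lemma shift_mul_rawE (s t : seq Z) (a b : coefs) :
  uniq s -> uniq t ->
  (forall k, k \notin s -> a k = 0) -> (forall l, l \notin t -> b l = 0) ->
  shift_mul_raw a b = \sum_(k <- s) \sum_(l <- t) mono (k + l) (term a b k l).
Proof.
move=> us ut sa tb; rewrite /shift_mul_raw.
rewrite (fsum_seq us); last first.
  move=> k /sa ak; rewrite fsbig1// => l _.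
  rewrite (_ : (fun _ => _) = 0) ?mono0//; apply/funext => u.
  by rewrite ak mul0r mulr0.
apply: eq_bigr => k _; rewrite (fsum_seq ut)// => l /tb bl.
rewrite (_ : (fun _ => _) = 0) ?mono0//; apply/funext => u.
by rewrite /shiftS bl mulr0 mulr0.
Qed.

Lemma mono_in k f : F f -> mono k f \in shift_pred ssF.
Proof.
move=> Ff; apply/shift_predP; split=> [|l]; last first.
  by rewrite /mono; case: ifP => // _; exact: (ssa0 ssF).
apply: (sub_finite_set _ (finite_set1 k)) => l /=.
by rewrite /mono; case: eqP.
Qed.

Lemma shift_elt_seq (a : shift_elt) :
  exists2 s : seq Z, uniq s & forall k, k \notin s -> a k = 0.
Proof. by case: a => a /= /shift_predP[/finsupp_seq]. Qed.

Lemma shift_elt_seq2 (a b : shift_elt) : exists s : seq Z,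
  [/\ uniq s, forall k, k \notin s -> a k = 0 & forall k, k \notin s -> b k = 0].
Proof.
have [s us sa] := shift_elt_seq a; have [t ut tb] := shift_elt_seq b.
exists (undup (s ++ t)); split=> [|k|k]; first exact: undup_uniq.
  by rewrite mem_undup mem_cat negb_or => /andP[/sa].
by rewrite mem_undup mem_cat negb_or => /andP[_ /tb].
Qed.

Lemma shift_eltF (a : shift_elt) k : F (a k).
Proof. by case: a => a /= /shift_predP[_]. Qed.

Lemma shift_mul_in (a b : shift_elt) : shift_mul_raw a b \in shift_pred ssF.
Proof.
have [s us sa] := shift_elt_seq a; have [t ut tb] := shift_elt_seq b.
rewrite (shift_mul_rawE us ut sa tb).
apply: rpred_sum => k _; apply: rpred_sum => l _; apply: mono_in.
apply: (ssaZ ssF); apply: (ssaM ssF); first exact: shift_eltF.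
by apply: invF; exact: shift_eltF.
Qed.

Definition shift_mul (a b : shift_elt) : shift_elt := ShiftElt (shift_mul_in a b).

Fact shift_mulDl : left_distributive shift_mul +%R.
Proof.
move=> a b c; apply/val_inj; rewrite /=.
have [s [us sa sb]] := shift_elt_seq2 a b; have [t ut tc] := shift_elt_seq c.
have sab k : k \notin s -> (a + b : shift_elt) k = 0.
  by move=> ks; rewrite (_ : _ k = a k + b k)// sa// sb// addr0.
rewrite (shift_mul_rawE us ut sab tc) (shift_mul_rawE us ut sa tc).
rewrite (shift_mul_rawE us ut sb tc) -big_split; apply: eq_bigr => k _.
rewrite -big_split; apply: eq_bigr => l _ /=; rewrite -monoD; congr mono.
by apply/funext => u; rewrite /term !fctE -mulrDr -mulrDl.
Qed.

Fact shift_mulDr : right_distributive shift_mul +%R.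
Proof.
move=> c a b; apply/val_inj; rewrite /=.
have [s [us sa sb]] := shift_elt_seq2 a b; have [t ut tc] := shift_elt_seq c.
have sab k : k \notin s -> (a + b : shift_elt) k = 0.
  by move=> ks; rewrite (_ : _ k = a k + b k)// sa// sb// addr0.
rewrite (shift_mul_rawE ut us tc sab) (shift_mul_rawE ut us tc sa).
rewrite (shift_mul_rawE ut us tc sb) -big_split; apply: eq_bigr => k _.
rewrite -big_split; apply: eq_bigr => l _ /=; rewrite -monoD; congr mono.
by apply/funext => u; rewrite /term /shiftS !fctE -mulrDr -mulrDr.
Qed.

Fact shift_mulZl (c : C) a b : shift_mul (c *: a) b = c *: shift_mul a b.
Proof.
apply/val_inj; rewrite /=.
have [s us sa] := shift_elt_seq a; have [t ut tb] := shift_elt_seq b.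
have sca k : k \notin s -> (c *: a : shift_elt) k = 0.
  by move=> ks; rewrite (_ : _ k = c *: a k)// sa// scaler0.
rewrite (shift_mul_rawE us ut sca tb) (shift_mul_rawE us ut sa tb).
rewrite scaler_sumr; apply: eq_bigr => k _.
rewrite scaler_sumr; apply: eq_bigr => l _; rewrite -monoZ; congr mono.
apply/funext => u; rewrite /term.
by rewrite (_ : (c *: a : shift_elt) k u = c * a k u)// -mulrA mulrCA.
Qed.

Fact shift_mulZr (c : C) a b : shift_mul a (c *: b) = c *: shift_mul a b.
Proof.
apply/val_inj; rewrite /=.
have [s us sa] := shift_elt_seq a; have [t ut tb] := shift_elt_seq b.
have scb k : k \notin t -> (c *: b : shift_elt) k = 0.
  by move=> ks; rewrite (_ : _ k = c *: b k)// tb// scaler0.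
rewrite (shift_mul_rawE us ut sa scb) (shift_mul_rawE us ut sa tb).
rewrite scaler_sumr; apply: eq_bigr => k _.
rewrite scaler_sumr; apply: eq_bigr => l _; rewrite -monoZ; congr mono.
apply/funext => u; rewrite /term /shiftS; set q := qpow _ _; set v := u + _.
rewrite -[LHS]/(q * (a k u * (c * b l v))) -[RHS]/(c * (q * (a k u * b l v))).
by rewrite [a k u * (c * _)]mulrCA [LHS]mulrCA.
Qed.

Definition smono k f (Ff : F f) : shift_elt := ShiftElt (mono_in k Ff).

Lemma shift_elt_ind (P : shift_elt -> Prop) :
  P 0 -> (forall a b, P a -> P b -> P (a + b)) ->
  (forall k f (Ff : F f), P (smono k Ff)) -> forall a, P a.
Proof.
move=> P0 PD Pm a; have [s us sa] := shift_elt_seq a.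
have -> : a = \sum_(k <- s) smono k (shift_eltF a k).
  apply/val_inj; rewrite raddf_sum /=; apply/funext => l.
  rewrite fct_sumE /mono; have [ls|ls] := boolP (l \in s).
    rewrite (bigD1_seq l)//= eqxx big1 ?addr0// => k kl.
    by rewrite eq_sym (negPf kl).
  rewrite big1_seq ?sa// => k /= ks; case: eqP => // lk.
  by rewrite -lk (negPf ls) in ks.
by apply: big_ind => // k _; exact: Pm.
Qed.

Lemma shift_mul_mono k l f g (Ff : F f) (Fg : F g) :
  val (shift_mul (smono k Ff) (smono l Fg)) = mono (k + l) (fun u =>
    qpow theta (NN (vecZ K k) (vecZ K l)) * (f u * shiftS hbar k g u)).
Proof.
rewrite /= (@shift_mul_rawE [:: k] [:: l])//.
- rewrite !big_seq1; congr mono; apply/funext => u.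
  by rewrite /term /shiftS /mono !eqxx.
- by move=> k'; rewrite /mono inE => /negPf->.
- by move=> k'; rewrite /mono inE => /negPf->.
Qed.

Fact shift_mulA : associative shift_mul.
Proof.
move=> a b c; move: a b c.
have mul0 a : shift_mul 0 a = 0 by rewrite -[0](scale0r 0) shift_mulZl !scale0r.
have mul1 a : shift_mul a 0 = 0 by rewrite -[0](scale0r 0) shift_mulZr !scale0r.
elim/shift_elt_ind => [b c|a a' IH IH' b c|k f Ff]; first by rewrite !mul0.
  by rewrite !shift_mulDl IH IH'.
elim/shift_elt_ind => [c|b b' IH IH' c|l g Fg].
- by rewrite mul0 mul1 mul0.
- by rewrite shift_mulDl !shift_mulDr shift_mulDl IH IH'.
elim/shift_elt_ind => [|c c' IH IH'|m h Fh]; first by rewrite !mul1.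
  by rewrite !shift_mulDr IH IH'.
have FX k0 l0 f0 g0 (Ff0 : F f0) (Fg0 : F g0) : F (fun u =>
    qpow theta (NN (vecZ K k0) (vecZ K l0)) * (f0 u * shiftS hbar k0 g0 u)).
  by apply: (ssaZ ssF); apply: (ssaM ssF) => //; exact: invF.
have mE k0 l0 f0 g0 (Ff0 : F f0) (Fg0 : F g0) :
    shift_mul (smono k0 Ff0) (smono l0 Fg0) = smono (k0 + l0) (FX k0 l0 _ _ Ff0 Fg0).
  by apply/val_inj; rewrite shift_mul_mono.
rewrite [shift_mul (smono l Fg) _]mE [shift_mul (smono k Ff) (smono l Fg)]mE.
apply/val_inj; rewrite !shift_mul_mono addrA; congr mono; apply/funext => u.
rewrite /shiftS !vecZD NNDl NNDr !qpowD scalerDr addrA.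
have E (x y z w1 w2 w3 : C) :
  x * y * (w1 * (z * (w2 * w3))) = y * z * ((x * (w1 * w2)) * w3) by ring.
exact: E.
Qed.

Definition shift_algebra : nuAlgebra C :=
  NUAlgebra shift_mulA shift_mulDl shift_mulDr shift_mulZl shift_mulZr.

End ShiftAlgebra.

Section ShiftModule.
Variables (K : realType) (D : nat) (F : set (funsp K D)) (hbar theta : K).
Hypothesis ssF : star_subalgebra F.
Hypothesis invF : shift_invariant hbar F.
Variables (R : 'M[int]_D) (delta : 'cV[K]_D).
Hypothesis detR : \det R != 0.

Local Notation C := (K[i]).
Local Notation Z := ('cV[int]_D).
Local Notation E := (shift_elt ssF).
Local Notation mulE := (shift_mul theta invF).
Local Notation A := (shift_algebra theta ssF invF).

Definition fs_pred : {pred Z -> C^o} := fun xi => `[< finsupp_fun xi >].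

Fact fs_pred_submod : submod_closed fs_pred.
Proof.
split; first by apply/asboolP; exact: finsupp_fun0.
move=> c x y /asboolP fx /asboolP fy; apply/asboolP.
apply: finsupp_funD => //; apply: sub_finite_set fx => k /=.
by apply: contra_not => xk; rewrite -[LHS]/(c *: x k) xk scaler0.
Qed.

HB.instance Definition _ :=
  GRing.isSubmodClosed.Build C (Z -> C^o) fs_pred fs_pred_submod.

Record fs_elt := FSElt { fs_fun :> Z -> C^o; _ : fs_fun \in fs_pred }.
HB.instance Definition _ := [isSub for fs_fun].
HB.instance Definition _ := [Choice of fs_elt by <:].
HB.instance Definition _ := [SubChoice_isSubLmodule of fs_elt by <:].

(* R^{-1} k + delta *)
Definition node (k : Z) : 'cV[K]_D :=
  invmx (map_mx intr R) *m vecZ K k + delta.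

Definition act_raw (a : Z -> funsp K D) (xi : Z -> C^o) : Z -> C^o := fun k =>
  \sum_(n \in [set: Z])
     qpow theta (NN (node k) (vecZ K n)) * a n (hbar *: node k) * xi (k + R *m n).

Lemma node_shift k n : node (k + R *m n) = node k + vecZ K n.
Proof.
rewrite /node vecZD mulmxDr addrAC; congr (_ + _).
rewrite /vecZ map_mxM mulmxA mulVmx ?mul1mx//.
by rewrite unitmxE det_map_mx unitfE intr_eq0.
Qed.

Lemma act_rawE (s : seq Z) (a : Z -> funsp K D) xi k :
  uniq s -> (forall n, n \notin s -> a n = 0) ->
  act_raw a xi k = \sum_(n <- s)
     qpow theta (NN (node k) (vecZ K n)) * a n (hbar *: node k) * xi (k + R *m n).
Proof.
by move=> us sa; rewrite /act_raw (fsum_seq us)// => n /sa ->; rewrite mulr0 mul0r.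
Qed.

Lemma act_in (a : E) (xi : fs_elt) : act_raw a xi \in fs_pred.
Proof.
have [s us sa] := shift_elt_seq a.
have -> : act_raw a xi = \sum_(n <- s) (fun k =>
    qpow theta (NN (node k) (vecZ K n)) * a n (hbar *: node k)
      * xi (k + R *m n)) :> (Z -> C^o).
  by apply/funext => k; rewrite fct_sumE (act_rawE _ _ us sa).
apply: rpred_sum => n _; apply/asboolP.
case: xi => xi /= /asboolP fxi.
apply: sub_finite_set (finite_image (fun k => k - R *m n) fxi) => k /= h.
exists (k + R *m n); last by rewrite addrK.
by move=> xi0; apply: h; rewrite xi0 mulr0.
Qed.

Definition act (a : E) (xi : fs_elt) : fs_elt := FSElt (act_in a xi).

Fact actDl (a b : E) x : act (a + b) x = act a x + act b x.
Proof.
apply/val_inj/funext => k.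
have [s [us sa sb]] := shift_elt_seq2 a b.
have sab n : n \notin s -> (a + b : E) n = 0.
  by move=> ns; rewrite (_ : _ n = a n + b n)//
    sa// sb// addr0.
rewrite -[RHS]/(act a x k + act b x k) /= (act_rawE _ _ us sab).
rewrite (act_rawE _ _ us sa) (act_rawE _ _ us sb) -big_split.
by apply: eq_bigr => n _ /=; rewrite -mulrDl -mulrDr.
Qed.

Fact actZl (c : C) (a : E) x : act (c *: a) x = c *: act a x.
Proof.
apply/val_inj/funext => k.
have [s us sa] := shift_elt_seq a.
have sca n : n \notin s -> (c *: a : E) n = 0.
  by move=> ns; rewrite (_ : _ n = c *: a n)// sa// scaler0.
rewrite -[RHS]/(c *: act a x k) /= (act_rawE _ _ us sca) (act_rawE _ _ us sa).
rewrite scaler_sumr; apply: eq_bigr => n _.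
set q := qpow _ _; set z := x _; set v := hbar *: _.
rewrite -[LHS]/(q * (c * a n v) * z) -[RHS]/(c * (q * a n v * z)).
have eqC (y1 y2 y3 y4 : C) : y1 * (y2 * y3) * y4 = y2 * (y1 * y3 * y4) by ring.
exact: eqC.
Qed.

Fact actDr (a : E) x y : act a (x + y) = act a x + act a y.
Proof.
apply/val_inj/funext => k; have [s us sa] := shift_elt_seq a.
rewrite -[RHS]/(act a x k + act a y k) /= !(act_rawE _ _ us sa) -big_split.
by apply: eq_bigr => n _ /=; rewrite -mulrDr.
Qed.

Fact actZr (c : C) (a : E) x : act a (c *: x) = c *: act a x.
Proof.
apply/val_inj/funext => k; have [s us sa] := shift_elt_seq a.
rewrite -[RHS]/(c *: act a x k) /= !(act_rawE _ _ us sa).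
rewrite scaler_sumr; apply: eq_bigr => n _.
set q := qpow _ _; set v := hbar *: _; set m := k + _.
rewrite -[LHS]/(q * a n v * (c * x m)) -[RHS]/(c * (q * a n v * x m)).
have eqC (y1 y2 y3 y4 : C) : y1 * y3 * (y2 * y4) = y2 * (y1 * y3 * y4) by ring.
exact: eqC.
Qed.

Lemma act_raw_mono n f x k : act_raw (mono n f) x k =
  qpow theta (NN (node k) (vecZ K n)) * f (hbar *: node k) * x (k + R *m n).
Proof.
rewrite (@act_rawE [:: n])//; first by rewrite big_seq1 /mono eqxx.
by move=> m; rewrite /mono inE => /negPf->.
Qed.

Fact actM (a b : E) x : act (mulE a b) x = act a (act b x).
Proof.
move: a b; have act0 y : act 0 y = 0.
  by rewrite -[0 in LHS](scale0r 0) actZl scale0r.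
have act1 a : act a 0 = 0 by rewrite -[0 in LHS](scale0r 0) actZr scale0r.
have mul0 (b : E) : mulE 0 b = 0 by rewrite -[0](scale0r 0) shift_mulZl !scale0r.
have mul1 (b : E) : mulE b 0 = 0 by rewrite -[0](scale0r 0) shift_mulZr !scale0r.
elim/shift_elt_ind => [b|a a' IH IH' b|k f Ff]; first by rewrite mul0 !act0.
  by rewrite shift_mulDl !actDl IH IH'.
elim/shift_elt_ind => [|b b' IH IH'|l g Fg]; first by rewrite mul1 act0 act1.
  by rewrite shift_mulDr !actDl actDr IH IH'.
apply/val_inj/funext => m; rewrite /=.
rewrite -[shift_mul_raw _ _ _ _]/(val (mulE (smono ssF k Ff) (smono ssF l Fg))).
rewrite (shift_mul_mono theta ssF invF k l Ff Fg).
rewrite !act_raw_mono node_shift mulmxDr addrA /shiftS vecZD.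
rewrite NNDl NNDr !qpowD [hbar *: (node m + _)]scalerDr.
have eqC (x1 y1 z1 w1 w2 w3 : C) :
  x1 * y1 * (z1 * (w1 * w2)) * w3 = x1 * w1 * (y1 * z1 * w2 * w3) by ring.
exact: eqC.
Qed.

Definition shift_module : leftModule A :=
  @LeftModule C A fs_elt act actM actDl actDr actZl actZr.

End ShiftModule.

(* Main.v *)
Require Import Defs.
From mathcomp Require Import all_boot all_order all_algebra.
From mathcomp Require Import complex.
From mathcomp Require Import boolp classical_sets cardinality functions reals trigo.

Set Implicit Arguments.
Unset Strict Implicit.
Unset Printing Implicit Defensive.

Import Order.TTheory GRing.Theory Num.Theory.
Local Open Scope classical_set_scope.
Local Open Scope ring_scope.

(** The finitely supported functions vanishing off the lattice R Z^D form a
    nonzero submodule, which is proper unless R is onto.  Conversely, F has a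
    function that is nonzero at one node and vanishes at finitely many others,
    so a nonzero submodule contains some Dirac function; the monomials f U^n
    move it along R Z^D, which is everything when R is unimodular. *)

Section Interpolation.
Variables (K : realType) (D : nat) (F : set (funsp K D)).
Hypotheses (ssF : star_subalgebra F) (sepF : separates_points F).

(* F need not contain 1; but a common zero of F would yield, by shift
   invariance, two common zeros, which F could not separate. *)
Lemma shift_invariant_nonvanishing (hbar : K) (x : 'cV[K]_D) :
  (0 < D)%N -> hbar != 0 -> shift_invariant hbar F -> exists2 f, F f & f x != 0.
Proof.
move=> D0 h0 invF.
pose y := x + hbar *: vecZ K (const_mx 1).
have xy : x <> y.
  move=> /(congr1 (fun u : 'cV[K]_D => u (Ordinal D0) 0)) /eqP.
  by rewrite !mxE mulr1 eq_sym -subr_eq0 addrAC subrr add0r (negPf h0).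
have [f Ff fxy] := sepF xy.
have [fx0|fx0] := eqVneq (f x) 0; last by exists f.
exists (shiftS hbar (const_mx 1) f); first exact: invF.
by apply/eqP => fy0; apply: fxy; rewrite fx0 -fy0.
Qed.

Hypothesis nvF : forall x, exists2 f, F f & f x != 0.

(** A separating [g] cannot simply be replaced by [g - g y], since [F] may lack the constants. Both
    witnesses below therefore use only products and linear combinations of members of [F]. *)
Lemma separates_points_zero (x y : 'cV[K]_D) : x != y ->
  exists f, [/\ F f, f x != 0 & f y = 0].
Proof.
move=> /eqP /sepF [g Fg gxy].
have [gx0|gx0] := eqVneq (g x) 0; last first.
  (* This is [g * (g - g y)]: at [x] both factors are nonzero. *)
  exists (fun u => g u * g u + (- g y) * g u); split.
  - by apply: (ssaD ssF); [exact: (ssaM ssF)|exact: (ssaZ ssF)].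
  - by rewrite -mulrDl mulf_neq0// subr_eq0; apply/eqP.
  - by rewrite mulNr subrr.
have gy0 : g y != 0 by apply/eqP => gy0; apply: gxy; rewrite gx0 gy0.
have [h Fh hx0] := nvF x.
(* Here [g x = 0] and [g y != 0], so subtracting a multiple of [g] cancels [h] at [y] and leaves its
   value at [x] unchanged. *)
exists (fun u => h u + (- (h y / g y)) * g u); split.
- by apply: (ssaD ssF) => //; exact: (ssaZ ssF).
- by rewrite gx0 mulr0 addr0.
- by rewrite mulNr mulfVK// subrr.
Qed.

(** Multiply one separating function per point of [s]. The induction starts from a function given by
    [nvF], standing in for the empty product 1. *)
Lemma separates_points_seq (x : 'cV[K]_D) (s : seq 'cV[K]_D) : x \notin s ->
  exists f, [/\ F f, f x != 0 & forall y, y \in s -> f y = 0].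
Proof.
elim: s => [_|y s IH]; first by have [f Ff fx] := nvF x; exists f.
rewrite inE negb_or => /andP[xy /IH [f [Ff fx fs]]].
have [g [Fg gx gy]] := separates_points_zero xy.
exists (fun u => f u * g u); split; first exact: (ssaM ssF).
  by rewrite mulf_neq0.
move=> z; rewrite inE => /orP[/eqP ->|/fs ->]; first by rewrite gy mulr0.
by rewrite mul0r.
Qed.

End Interpolation.

Section Dirac.
Variables (K : realType) (D : nat).
Local Notation Z := 'cV[int]_D.

Fact dirac_in (k : Z) : (fun l => (l == k)%:R) \in @fs_pred K D.
Proof.
apply/asboolP; apply: (sub_finite_set _ (finite_set1 k)) => l /=.
by case: eqP.
Qed.

Definition dirac (k : Z) : fs_elt K D := FSElt (dirac_in k).

Lemma diracE k l : dirac k l = (l == k)%:R.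
Proof. by []. Qed.

Lemma dirac_neq0 k : dirac k <> 0.
Proof.
move=> /(congr1 (fun x : fs_elt K D => x k)); rewrite diracE eqxx.
by apply/eqP; exact: oner_neq0.
Qed.

Lemma fs_elt_seq (x : fs_elt K D) :
  exists2 s : seq Z, uniq s & forall k, k \notin s -> x k = 0.
Proof. by case: x => x /= /asboolP /finsupp_seq. Qed.

Lemma fs_elt_dirac (s : seq Z) (x : fs_elt K D) :
  uniq s -> (forall k, k \notin s -> x k = 0) ->
  x = \sum_(k <- s) (x k : K[i]) *: dirac k.
Proof.
move=> us sx; apply/val_inj; rewrite raddf_sum /=; apply/funext => l.
rewrite fct_sumE.
have E k : ((x k : K[i]) *: (dirac k : Z -> K[i]^o)) l = x k * (l == k)%:R by [].
under eq_bigr do rewrite E.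
have [ls|ls] := boolP (l \in s).
  rewrite (bigD1_seq l)//= eqxx mulr1 big1 ?addr0// => k kl.
  by rewrite eq_sym (negPf kl) mulr0.
rewrite big1_seq ?sx// => k /= ks; case: eqP => [lk|]; last by rewrite mulr0.
by rewrite -lk (negPf ls) in ks.
Qed.

End Dirac.

Section Simplicity.
Variables (K : realType) (D : nat) (F : set (funsp K D)) (hbar theta : K).
Hypotheses (ssF : star_subalgebra F) (invF : shift_invariant hbar F).
Variables (R : 'M[int]_D) (delta : 'cV[K]_D).
Hypothesis detR : \det R != 0.

Local Notation Z := 'cV[int]_D.
Local Notation M := (shift_module theta ssF invF delta detR).

Lemma expi_neq0 (t : K) : expi t != 0.
Proof.
rewrite /expi eq_complex /=; apply/negP => /andP[/eqP c0 /eqP s0].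
by have := cos2Dsin2 t; rewrite c0 s0 expr0n /= addr0 => /esym/eqP; rewrite oner_eq0.
Qed.

(** Since [R] is invertible over [K], distinct indices give distinct evaluation points, which [F]
    can then separate. *)
Lemma node_inj : injective (node R delta).
Proof.
move=> k l /addIr /(congr1 (mulmx (map_mx intr R))).
rewrite !mulmxA mulmxV ?mul1mx; last first.
  by rewrite unitmxE det_map_mx unitfE intr_eq0.
by move=> /matrixP kl; apply/matrixP => i j;
  have := kl i j; rewrite !mxE => /intr_inj.
Qed.

Definition lattice_supported : set M :=
  [set x : fs_elt K D | forall k : Z, x k <> 0 -> exists n, k = R *m n].

(** The value of [a x] at [k] involves only the values of [x] on the coset [k + R Z^D], and this
    coset misses the lattice when [k] does. *)
Lemma lattice_supported_submodule : is_submodule lattice_supported.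
Proof.
split=> [k //|x y Vx Vy k|c x Vx k|a x Vx k].
- rewrite (_ : fs_fun (x + y) k = (x : fs_elt K D) k + (y : fs_elt K D) k)//.
  have [x0|/eqP/Vx//] := eqVneq ((x : fs_elt K D) k) 0.
  by rewrite x0 add0r; exact: Vy.
- rewrite (_ : fs_fun (c *: x) k = c * (x : fs_elt K D) k)// => cx0; apply: Vx.
  by move=> x0; apply: cx0; rewrite x0 mulr0.
- have [s us sa] := shift_elt_seq a.
  rewrite /= (act_rawE _ _ _ _ _ _ us sa) => sum0.
  apply: contrapT => nk; apply: sum0; apply: big1_seq => n _.
  suff -> : (x : fs_elt K D) (k + R *m n) = 0 by rewrite mulr0.
  apply: contrapT => /Vx [m km]; apply: nk; exists (m - n).
  by rewrite mulmxBr -km addrK.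
Qed.

Lemma simple_shift_module_unitmx : simple_module M -> R \in unitmx.
Proof.
move=> [_ /(_ _ lattice_supported_submodule) simpM].
have VT : lattice_supported = setT.
  case: simpM => // V0; case: (@dirac_neq0 K D 0).
  suff : lattice_supported (dirac K 0) by rewrite V0.
  by move=> k; rewrite diracE; case: eqP => // -> _; exists 0; rewrite mulmx0.
have surjR (k : Z) : exists n, k = R *m n.
  have : lattice_supported (dirac K k) by rewrite VT.
  by apply; rewrite diracE eqxx; apply/eqP; exact: oner_neq0.
have [g gP] := choice surjR.
(* The columns of this matrix are preimages of the standard basis vectors; a one-sided inverse of a
   square matrix over a commutative ring makes it a unit. *)
suff : R *m (\matrix_(i, j) g (col j 1%:M) i 0) = 1%:M by case/mulmx1_unit.
apply/matrixP => i j; have := congr1 (fun u : Z => u i 0) (gP (col j 1%:M)).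
by rewrite !mxE => ->; apply: eq_bigr => l _; rewrite !mxE.
Qed.

Section Transitivity.
Hypotheses (hbar0 : hbar != 0) (D0 : (0 < D)%N) (sepF : separates_points F).
Variable V : set M.
Hypothesis subV : is_submodule V.

Let nvF x : exists2 f, F f & f x != 0.
Proof. exact: (shift_invariant_nonvanishing sepF x D0 hbar0 invF). Qed.

Lemma submodule_dirac_scale (c : K[i]) k :
  c != 0 -> V (c *: dirac K k) -> V (dirac K k).
Proof.
case: subV => _ _ VZ _ c0 /(VZ c^-1).
by rewrite scalerA mulVf// scale1r.
Qed.

(** A monomial [f U^0] acts diagonally, multiplying [x l] by [f] at the scaled node of [l], up to a
    nonzero phase. A suitable [f] thus isolates the coordinate [k]. *)
Lemma submodule_has_dirac (x : fs_elt K D) k : V x -> x k != 0 -> V (dirac K k).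
Proof.
move=> Vx xk; have [s us sx] := fs_elt_seq x.
(* The points to kill are the scaled nodes of the other indices in [s], which contains the support
   of [x]. *)
have [|f [Ff fk fs]] := separates_points_seq ssF sepF nvF
    (x := hbar *: node R delta k)
    (s := [seq hbar *: node R delta l | l <- s & l != k]).
  apply/mapP => -[l]; rewrite mem_filter => /andP[lk _].
  by move=> /(scalerI hbar0) /node_inj kl; rewrite kl eqxx in lk.
pose a : shift_elt ssF := smono ssF 0 Ff.
have := subV => -[_ _ _ /(_ a x Vx)].
pose c : K[i] :=
  qpow theta (NN (node R delta k) (vecZ K 0)) * f (hbar *: node R delta k) * x k.
have nz : c != 0 by rewrite !mulf_neq0// expi_neq0.
suff -> : lm_act (l := M) a x = c *: dirac K k by exact: submodule_dirac_scale nz.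
apply/val_inj/funext => l; rewrite [LHS]/= act_raw_mono mulmx0 addr0.
rewrite -[RHS]/(c * (l == k)%:R); have [->|lk] := eqVneq l k; first by rewrite mulr1.
rewrite mulr0; have [ls|/sx ->] := boolP (l \in s); last by rewrite mulr0.
by rewrite fs ?mulr0 ?mul0r//; apply/mapP; exists l; rewrite // mem_filter lk.
Qed.

(** For [f] nonzero at the scaled node of [k], the monomial [f U^n] sends the Dirac function at
    [k + R n] to a nonzero multiple of the one at [k]. *)
Lemma submodule_dirac_shift k n : V (dirac K (k + R *m n)) -> V (dirac K k).
Proof.
move=> Vx; have [f Ff fk] := nvF (hbar *: node R delta k).
pose a : shift_elt ssF := smono ssF n Ff.
have := subV => -[_ _ _ /(_ a _ Vx)].
pose c : K[i] :=
  qpow theta (NN (node R delta k) (vecZ K n)) * f (hbar *: node R delta k).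
have nz : c != 0 by rewrite mulf_neq0// expi_neq0.
suff -> : lm_act (l := M) a (dirac K (k + R *m n)) = c *: dirac K k
  by exact: submodule_dirac_scale nz.
apply/val_inj/funext => l; rewrite [LHS]/= act_raw_mono.
rewrite -[RHS]/(c * (l == k)%:R) (inj_eq (addIr _)).
by have [->//|_] := eqVneq l k; rewrite !mulr0.
Qed.

Lemma submodule_trivial : R \in unitmx -> V = [set 0] \/ V = setT.
Proof.
move=> uR; have [V0 VD VZ _] := subV.
have [Vz|] := pselect (forall x, V x -> x = 0).
  by left; apply/seteqP; split=> [x /Vz//|x ->].
move=> /existsNP[x /not_implyP[Vx x0]]; right.
have [k xk] : exists k, (x : fs_elt K D) k != 0.
  apply: contrapT => nx; apply: x0; apply/val_inj/funext => k.
  by apply/eqP; apply: contra_notT nx => xk; exists k.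
have Vd l : V (dirac K l).
  (* With [R] unimodular, [n = R^-1 (k - l)] is an integer vector and [l + R n = k]. *)
  apply: (@submodule_dirac_shift l (invmx R *m (k - l))).
  by rewrite mulKVmx// addrC subrK; exact: submodule_has_dirac Vx xk.
apply/seteqP; split=> // y _; have [s us sy] := fs_elt_seq y.
rewrite (fs_elt_dirac us sy); apply: big_ind => // l _.
exact: VZ.
Qed.

End Transitivity.
End Simplicity.

Theorem proposition3p13 (K : realType) (D : nat) (hD : (1 <= D)%N)
  (hbar : K) (hhbar : 0 < hbar)
  (q : K[i]) (hq : `|q| = 1) (theta : K) (htheta : q = expi theta)
  (F : set (funsp K D)) (ssF : star_subalgebra F)
  (invF : shift_invariant hbar F) (sepF : separates_points F)
  (R : 'M[int]_D) (detR : \det R != 0) (delta : 'cV[K]_D) :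
  simple_module (shift_module theta ssF invF delta detR) <-> R \in unitmx.
Proof.
split; first exact: simple_shift_module_unitmx.
move=> uR; split; first by exists (dirac K 0); exact: dirac_neq0.
by move=> V subV; exact: (submodule_trivial (lt0r_neq0 hhbar) hD sepF subV uR).
Qed.
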